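(* Let $\mathrm{U}$ be a countable, oligomorphic, homogeneous relational structure. If all types of $\mathrm{U}$ have the same rank (i.e. the set $\mathfrak{R}(\mathrm{U})$ of ranks of types of $\mathrm{U}$ has exactly one element), then $\mathrm{U}$ is indivisible.
   Context: Relational languages have no $0$-ary symbols; relations hold only on tuples of pairwise distinct elements. Embeddings are injections preserving and reflecting all relations; the age of a structure is the class of finite structures embeddable in it. Homogeneous: every isomorphism between finite induced substructures extends to an automorphism. Oligomorphic: the automorphism group $\mathrm{G}$ has finitely many orbits on $n$-tuples for each $n$. A type is $\langle F\mid x\rangle$ with $F\subseteq U$ finite and $x\in U\setminus F$; its typeset is $\{g(x):g\in\mathrm{G}_F\}$ where $\mathrm{G}_F$ is the pointwise stabilizer of $F$; its rank is the age of the induced substructure of $\mathrm{U}$ on its typeset. Indivisible: for every $c:U\to 2$ there is an embedding $f:\mathrm{U}\to\mathrm{U}$ with $c$ constant on $f[U]$. *)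

(* Defs.v *)
From mathcomp Require Import all_boot.
From mathcomp Require Import boolp classical_sets cardinality.
Set Implicit Arguments.
Unset Strict Implicit.
Unset Printing Implicit Defensive.
Local Open Scope classical_set_scope.

Record language := Language {
  symbol : Type;
  arity : symbol -> nat;
  arity_gt0 : forall s : symbol, (0 < arity s)%N }.

(* [n]-tuples are functions from ['I_n], so that a map [f] acts on a tuple [t]
   as [f \o t] and [t] has pairwise distinct entries iff it is injective. *)
Record structure (L : language) := Structure {
  carrier :> Type;
  holds : forall s : symbol L, set ('I_(arity s) -> carrier);
  holds_distinct : forall (s : symbol L) (t : 'I_(arity s) -> carrier),
    holds t -> injective t }.

Definition embedding (L : language) (A B : structure L) : set (A -> B) :=
  [set f | injective f /\
    forall (s : symbol L) (t : 'I_(arity s) -> A), holds t <-> holds (f \o t)].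

Definition isomorphism (L : language) (A B : structure L) : set (A -> B) :=
  [set f | bijective f /\ embedding f].

Definition automorphism (L : language) (U : structure L) : set (U -> U) :=
  @isomorphism L U U.

Lemma induced_distinct (L : language) (U : structure L) (A : set U)
    (s : symbol L) (t : 'I_(arity s) -> {x : U | A x}) :
  holds (fun i => sval (t i)) -> injective t.
Proof. by move=> ht i j tij; apply: (holds_distinct ht); rewrite tij. Qed.

(* The carrier is a plain sigma type because using [set_type A] as a carrier
   would make [set (structure L)] universe-inconsistent. *)
Definition induced (L : language) (U : structure L) (A : set U) :
    structure L :=
  @Structure L {x : U | A x} (fun s t => holds (fun i => sval (t i)))
    (@induced_distinct L U A).

Definition age (L : language) (U : structure L) : set (structure L) :=
  [set A : structure L | finite_set [set: A] /\ exists f : A -> U, embedding f].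

Definition homogeneous (L : language) (U : structure L) : Prop :=
  forall (A B : set U) (f : induced A -> induced B),
    finite_set A -> finite_set B -> isomorphism f ->
    exists2 g : U -> U, automorphism g &
      forall a : induced A, g (sval a) = sval (f a).

Definition tuple_orbit (L : language) (U : structure L) (n : nat)
    (t : 'I_n -> U) : set ('I_n -> U) :=
  [set g \o t | g in @automorphism L U].

Definition oligomorphic (L : language) (U : structure L) : Prop :=
  forall n : nat, finite_set (range (@tuple_orbit L U n)).

Definition pointwise_stabilizer (L : language) (U : structure L) (F : set U) :
    set (U -> U) :=
  [set g | automorphism g /\ forall x, F x -> g x = x].

(* The pair [(F, x)] encodes the type < F | x >. *)
Definition is_type (L : language) (U : structure L) : set (set U * U) :=
  [set p | finite_set p.1 /\ ~ p.1 p.2].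

Definition typeset (L : language) (U : structure L) (p : set U * U) : set U :=
  [set g p.2 | g in pointwise_stabilizer p.1].

Definition rank (L : language) (U : structure L) (p : set U * U) :
    set (structure L) :=
  age (induced (typeset p)).

Definition ranks (L : language) (U : structure L) : set (set (structure L)) :=
  [set rank p | p in @is_type L U].

Definition indivisible (L : language) (U : structure L) : Prop :=
  forall c : U -> bool, exists2 f : U -> U, embedding f &
    exists b : bool, forall y, range f y -> c y = b.

(* Main.v *)
(* Given a colouring, either an embedding into one colour can be built point by
   point as a limit of automorphisms, or the construction gets stuck, which means
   that some typeset [T] lies in the other colour. Homogeneity and the rank
   hypothesis make [U] a single orbit, so the rank of every type is the age of [U];
   Koenig's lemma, applied to the orbits of the stabilizer of [F] on partial
   embeddings into [T] (finitely many at each level by oligomorphy), then embeds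
   [U] into [T]. *)
Require Import Defs.
From mathcomp Require Import all_boot.
From mathcomp Require Import boolp classical_sets cardinality.
Local Open Scope classical_set_scope.

(** * Maps on finite pieces of a countable set *)

Definition agree_on {T V : Type} (A : set T) (f g : T -> V) : Prop :=
  forall x, A x -> f x = g x.

(** An embedding of the substructure induced on [A], carried by a total map whose values off [A] are
    irrelevant; stages with different domains then share one type. *)
Definition partial_embedding {L : language} {U : structure L} (A : set U)
    (f : U -> U) : Prop :=
  (forall x y, A x -> A y -> f x = f y -> x = y) /\
  forall (s : symbol L) (t : 'I_(arity s) -> U), (forall i, A (t i)) ->
    (holds t <-> holds (f \o t)).

Definition initial_segment {T : Type} (e : T -> nat) (n : nat) : set T :=
  [set x | e x < n].

Lemma finite_initial_segment {T : Type} (e : T -> nat) (n : nat) :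
  injective e -> finite_set (initial_segment e n).
Proof.
move=> einj; apply: (finite_preimage (B := `I_n) (f := e)) (finite_II n).
by move=> x y _ _; apply: einj.
Qed.

Lemma finite_set_range {T : Type} {A : set T} : finite_set A ->
  exists n (a : 'I_n -> T), A = range a.
Proof.
move=> /(@finite_seqP {classic T})[s ->].
exists (size s), (tnth (in_tuple s)); apply/seteqP; split=> x /=.
  by move=> /(tnthP (in_tuple s))[i ->]; exists i.
by move=> [i _ <-]; apply: (mem_tnth i (in_tuple s)).
Qed.

(** Otherwise each of the finitely many values has a bound past which it is never taken, and [o] at
    the largest bound has no value left. *)
Lemma infinite_pigeonhole {T : Type} (D : set T) (o : nat -> T) :
  finite_set D -> (forall m, D (o m)) ->
  exists2 d, D d & forall N, exists2 m, N <= m & o m = d.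
Proof.
move=> /finite_set_range[k [d ->]] Do; apply: contrapT => nD.
have /choice[N Nd] : forall i, exists N, forall m, N <= m -> o m <> d i.
  move=> i; apply: contrapT => nN; apply: nD; exists (d i); first by exists i.
  move=> N; apply: contrapT => nm; apply: nN; exists N => m Nm om.
  by apply: nm; exists m.
have [i _ oi] := Do (\max_(i < k) N i).
by apply: (Nd i (\max_(i < k) N i)) => //; apply: leq_bigmax.
Qed.

Lemma finite_tuple_initial_segment {T : Type} {e : T -> nat} {n : nat}
    (t : 'I_n -> T) :
  exists N, forall i, initial_segment e N (t i).
Proof.
exists (\max_(i < n) e (t i)).+1 => i.
by rewrite /initial_segment /= ltnS (leq_bigmax (F := fun i => e (t i))).
Qed.

Section OneStructure.
Context {L : language} {U : structure L}.
Implicit Types (f g : U -> U) (A : set U).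

(** * Automorphisms, partial embeddings and typesets *)

Lemma automorphism_id : @automorphism L U id.
Proof. by split; [exists id | split]. Qed.

Lemma automorphism_comp f g : automorphism f -> automorphism g ->
  automorphism (f \o g).
Proof.
move=> [fb [fi fh]] [gb [gi gh]]; split; first exact: bij_comp.
split; first exact: inj_comp.
by move=> s t; rewrite gh fh.
Qed.

Lemma automorphism_inverse f : automorphism f ->
  exists2 g, automorphism g & cancel f g.
Proof.
move=> [[g fg gf] [fi fh]]; exists g => //; split; first by exists f.
split; first exact: can_inj gf.
move=> s t; rewrite (fh s (g \o t)).
by have -> : f \o (g \o t) = t by apply: funext => i /=; rewrite gf.
Qed.

Lemma automorphism_partial_embedding A f : automorphism f ->
  partial_embedding A f.
Proof.
by move=> [_ [fi fh]]; split=> [x y _ _|s t _]; [apply: fi | apply: fh].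
Qed.

Lemma partial_embedding_agree A f g : agree_on A f g ->
  partial_embedding A f -> partial_embedding A g.
Proof.
move=> fg [fi fh]; split.
  by move=> x y Ax Ay; rewrite -!fg //; apply: fi.
move=> s t At; rewrite fh //.
by have -> : f \o t = g \o t by apply: funext => i /=; apply: fg.
Qed.

Lemma partial_embedding_comp A f g : automorphism g ->
  partial_embedding A f -> partial_embedding A (g \o f).
Proof.
move=> [_ [gi gh]] [fi fh]; split.
  by move=> x y Ax Ay /gi; apply: fi.
by move=> s t At; rewrite fh // gh.
Qed.

Lemma typeset_stabilizer (p : set U * U) g y :
  pointwise_stabilizer p.1 g -> typeset p y -> typeset p (g y).
Proof.
move=> [ag gp] [h [ah hp] <-]; exists (g \o h) => //.
split; first exact: automorphism_comp.
by move=> x px /=; rewrite hp // gp.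
Qed.

(** Stages chosen one after another stabilize on initial segments, which exhaust [U]. Each tuple is
    finite, so it lies in one segment and is tested at a single stage. The abstract [S] lets the
    greedy and the compactness constructions share this limit. *)
Lemma embedding_limit (e : U -> nat) (P : set U) (S : nat -> set (U -> U)) :
  (exists f, S 0 f) ->
  (forall n f, S n f -> exists2 g, S n.+1 g &
    agree_on (initial_segment e n) f g) ->
  (forall n f, S n f -> partial_embedding (initial_segment e n) f) ->
  (forall n f, S n f -> forall x, initial_segment e n x -> P (f x)) ->
  exists2 f : U -> U, @embedding L U U f & forall x, P (f x).
Proof.
move=> [f0 S0] Sstep Semb SP.
pose next n (f : {f | S n f}) := cid2 (Sstep n _ (svalP f)).
pose F := fix F n : {f | S n f} := if n is n'.+1
  then exist _ (s2val (next n' (F n'))) (s2valP (next n' (F n')))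
  else exist _ f0 S0.
have FS n : agree_on (initial_segment e n) (sval (F n)) (sval (F n.+1)).
  exact: (s2valP' (next n (F n))).
have Fle m n : m <= n ->
    agree_on (initial_segment e m) (sval (F m)) (sval (F n)).
  elim: n => [|n IHn]; first by rewrite leqn0 => /eqP ->.
  rewrite leq_eqVlt => /predU1P[-> //|]; rewrite ltnS => mn x mx.
  by rewrite (IHn mn) // FS //; apply: leq_trans mx mn.
(* Stage [(e x).+1] is the first whose segment contains [x]. *)
pose f x := sval (F (e x).+1) x.
have fF n : agree_on (initial_segment e n) f (sval (F n)).
  by move=> x nx; apply: Fle => //; rewrite /initial_segment /=.
have Ff n : agree_on (initial_segment e n) (sval (F n)) f.
  by move=> x nx; rewrite (fF n).
have fpe n : partial_embedding (initial_segment e n) f.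
  by apply: (partial_embedding_agree _ _ _ (Ff n)); apply/Semb/(svalP (F n)).
exists f; last first.
  move=> x; apply: (SP (e x).+1 _ (svalP (F (e x).+1))).
  by rewrite /initial_segment /=.
split=> [x y|s t].
  apply: (fpe (maxn (e x) (e y)).+1).1; rewrite /initial_segment /= ltnS.
    exact: leq_maxl.
  exact: leq_maxr.
by have [N tN] := finite_tuple_initial_segment (e := e) t; apply: (fpe N).2.
Qed.

(** Each stage is a global automorphism [f]. For the next point [x], the type of [f x] over the
    image of the earlier points has a realization in [P]; the automorphism [h] reaching it fixes
    that image, so [h \o f] keeps all earlier values. *)
Lemma greedy_embedding (e : U -> nat) (P : set U) : injective e ->
  (forall p, is_type p -> exists2 y, typeset p y & P y) ->
  exists2 f : U -> U, @embedding L U U f & forall x, P (f x).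
Proof.
move=> einj tP.
apply: (embedding_limit e P (fun n f => @automorphism L U f /\
    forall x, initial_segment e n x -> P (f x))) => [|n f [af fP]|n f [af _]|n f []//].
- by exists id; split=> //; apply: automorphism_id.
- have [[x xn]|nx] := pselect (exists x, e x = n); last first.
    (* [e] may miss the value [n]; the segment then gains no point. *)
    exists f => //; split=> // x; rewrite /initial_segment /= ltnS leq_eqVlt.
    by move=> /predU1P[xn|/fP//]; case: nx; exists x.
  have [|_ [h [ah hf] <-] Py] := tP (f @` initial_segment e n, f x).
    split=> /=; first exact/finite_image/finite_initial_segment.
    by move=> [y yn /(af.2.1) yx]; move: yn; rewrite yx /initial_segment /= xn ltnn.
  have fhf y : initial_segment e n y -> f y = h (f y).
    by move=> yn; rewrite hf //; exists y.
  exists (h \o f) => //; split; first exact: automorphism_comp.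
  move=> y; rewrite /initial_segment /= ltnS leq_eqVlt => /predU1P[yn|yn].
    by have -> : y = x by apply: einj; rewrite yn xn.
  by rewrite -fhf //; apply: fP.
- exact: automorphism_partial_embedding.
Qed.

(** Appending the values of [g m] on [A] to an enumeration of [F] gives tuples of one fixed length,
    hence finitely many orbits. An automorphism between two such tuples fixes [F], because their
    first blocks coincide. *)
Lemma pointwise_stabilizer_pigeonhole (F A : set U) (g : nat -> U -> U) :
  oligomorphic U -> finite_set F -> finite_set A ->
  exists m0, forall N, exists2 m, N <= m &
    exists2 h, pointwise_stabilizer F h & agree_on A (g m) (h \o g m0).
Proof.
move=> olig /finite_set_range[k [a ->]] /finite_set_range[l [b ->]].
pose t m (i : 'I_(k + l)) :=
  match split i with inl j => a j | inr j => g m (b j) end.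
have tl m j : t m (lshift l j) = a j by rewrite /t (unsplitK (inl j)).
have tr m j : t m (rshift k j) = g m (b j) by rewrite /t (unsplitK (inr j)).
have [|_ [t0 _ <-] io] := infinite_pigeonhole
    (range (@tuple_orbit L U (k + l))) (fun m => tuple_orbit (t m)) (olig _).
  by move=> m; exists (t m).
have [m0 _ om0] := io 0; exists m0 => N.
have [m Nm om] := io N; exists m => //.
have : tuple_orbit (t m) (t m) by exists id => //; apply: automorphism_id.
rewrite om -om0 => -[h ah htm]; exists h.
  split=> // _ [j _ <-].
  by rewrite -{2}(tl m) -htm /= tl.
by move=> _ [j _ <-]; rewrite -tr -htm /= tr.
Qed.

(** The tree of partial maps may branch infinitely, but has finite branching modulo the stabilizer
    of [p.1]. Composing with that stabilizer preserves both partial embeddings and the typeset, so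
    Koenig's argument goes through. *)
Lemma typeset_compactness (e : U -> nat) (p : set U * U) : injective e ->
  oligomorphic U -> finite_set p.1 ->
  (forall n, exists2 f, partial_embedding (initial_segment e n) f &
    forall x, initial_segment e n x -> typeset p (f x)) ->
  exists2 f : U -> U, @embedding L U U f & forall x, typeset p (f x).
Proof.
move=> einj olig pfin pn.
pose into n f := partial_embedding (initial_segment e n) f /\
  forall x, initial_segment e n x -> typeset p (f x).
(* [S n] consists of the maps whose restriction to the first [n] points extends
   to partial embeddings into the typeset with arbitrarily large domains. *)
pose S n f := forall m, n <= m ->
  exists2 g, into m g & agree_on (initial_segment e n) f g.
have Sinto n f : S n f -> into n f.
  move=> /(_ n (leqnn n))[g [ge gp] fg]; split.
    by apply: (partial_embedding_agree _ g) => // x nx; rewrite fg.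
  by move=> x nx; rewrite fg //; apply: gp.
apply: (embedding_limit e (typeset p) S) => [|n f Snf|n f /Sinto[]//|n f /Sinto[]//].
  by exists id => m _; have [g ge gp] := pn m; exists g.
(* The extensions [g m] of [f] have growing domains; infinitely many of them lie in one stabilizer
   orbit on the first [n.+1] points. *)
have /choice[g gP] : forall m, exists g, into (n.+1 + m) g /\
    agree_on (initial_segment e n) f g.
  by move=> m; have [|g] := Snf (n.+1 + m); [rewrite addSn ltnW // ltnS leq_addr|exists g].
have [m0 m0P] := pointwise_stabilizer_pigeonhole p.1 (initial_segment e n.+1) g
  olig pfin (finite_initial_segment e n.+1 einj).
exists (g m0); last exact: (gP m0).2.
move=> N nN; have [m Nm [h [ah hp] hg]] := m0P N.
(* Undoing [h] turns [g m], whose domain contains the first [N] points, into an extension of [g m0]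
   restricted to the first [n.+1]. *)
have [k ak hk] := automorphism_inverse h ah.
have kp : pointwise_stabilizer p.1 k.
  by split=> // x px; rewrite -{1}(hp x px) hk.
have sub x : initial_segment e N x -> initial_segment e (n.+1 + m) x.
  by move=> Nx; apply: leq_trans Nx _; apply: leq_trans Nm (leq_addl _ _).
exists (k \o g m); last by move=> x nx /=; rewrite hg //= hk.
have [[[gi gh] gp] _] := gP m; split.
  apply: partial_embedding_comp => //; split=> [x y /sub Nx /sub Ny|s t Nt].
    exact: gi.
  by apply: gh => i; apply: sub.
by move=> x /sub Nx /=; apply: typeset_stabilizer => //; apply: gp.
Qed.

(** * Induced substructures, homogeneity and ranks *)

Lemma induced_sval_inj (B : set U) : injective (sval : induced B -> U).
Proof.
move=> [x Bx] [y By] /= xy; move: Bx; rewrite xy => Bx.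
by rewrite (Prop_irrelevance Bx By).
Qed.

Lemma embedding_induced_partial (A B : set U) (f : induced A -> induced B) :
  embedding f ->
  exists2 g : U -> U, partial_embedding A g & forall x, A x -> B (g x).
Proof.
move=> [fi fh].
(* The value [x] off [A] is an arbitrary default. *)
pose g x := if pselect (A x) is left Ax then sval (f (exist _ x Ax)) else x.
have gE (x : induced A) : g (sval x) = sval (f x).
  case: x => x Ax; rewrite /g; case: pselect => //= Ax'.
  by rewrite (Prop_irrelevance Ax' Ax).
exists g; last by move=> x Ax; rewrite (gE (exist _ x Ax)); apply: svalP.
split=> [x y Ax Ay|s t At].
  rewrite (gE (exist _ x Ax)) (gE (exist _ y Ay)) => fxy.
  by case: (fi _ _ (induced_sval_inj B _ _ fxy)).
have := fh s (fun i => exist _ (t i) (At i)); rewrite /=.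
by have -> : g \o t = fun i => sval (f (exist _ (t i) (At i)))
  by apply: funext => i /=; rewrite (gE (exist _ (t i) (At i))).
Qed.

Lemma finite_induced (A : set U) : finite_set A -> finite_set [set: induced A].
Proof.
move=> fA; apply: sub_finite_set (finite_preimage (f := sval) _ fA).
  by move=> a _; apply: (svalP a).
by move=> x y _ _; apply: induced_sval_inj.
Qed.

Lemma embedding_inclusion (A B : set U) (AB : A `<=` B) :
  embedding ((fun a => exist _ (sval a) (AB _ (svalP a))) :
    induced A -> induced B).
Proof. by split=> // x y [] /induced_sval_inj. Qed.

(** Over the empty set a typeset is a full orbit. Equal ranks embed the one-point structure on [y]
    into the orbit of [x], at some [z]; homogeneity extends the map from [y] to [z] to an
    automorphism, so [y] lies in that orbit too. *)
Lemma homogeneous_transitive (x y : U) : homogeneous U ->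
  rank (set0, x) = rank (set0, y) -> typeset (set0, x) y.
Proof.
move=> hom rxy.
have yT : [set y] `<=` typeset (set0, y).
  by move=> _ ->; exists id => //; split=> //; apply: automorphism_id.
have : rank (set0, y) (induced [set y]).
  split; last by exists (fun a => exist _ (sval a) (yT _ (svalP a)));
    apply: embedding_inclusion.
  exact/finite_induced/finite_set1.
rewrite -rxy => -[_ [k [ki kh]]].
pose y0 : induced [set y] := exist _ y erefl.
pose z := sval (k y0).
have y0E (a : induced [set y]) : a = y0.
  by case: a => a ay; apply: induced_sval_inj.
pose f (a : induced [set y]) : induced [set z] := exist _ z erefl.
have [| | |g ag gy] := hom [set y] [set z] f; [exact: finite_set1..| |].
  split.
    exists (fun=> y0) => [a|b]; first by rewrite [RHS]y0E.
    by apply: induced_sval_inj; case: b => b bz /=.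
  split; first by move=> a b _; rewrite (y0E a) (y0E b).
  move=> s t; rewrite kh /=.
  (* Every tuple in a one-point structure is constant, so [k] and [f] act alike on it. *)
  suff -> : (fun i => sval (k (t i))) = fun i => z by [].
  by apply: funext => i; rewrite (y0E (t i)).
have [k0 ak0 kK] := automorphism_inverse g ag.
have -> : y = k0 z by rewrite -(kK y) (gy y0).
by apply: typeset_stabilizer (svalP (k y0)); split.
Qed.

(** By transitivity the typeset of [(set0, p.2)] is all of [U], so its rank contains every finite
    substructure. The rank of [p] is the same, so each initial segment embeds into the typeset of
    [p], and compactness applies. *)
Lemma one_rank_embedding_typeset (e : U -> nat) (p : set U * U) : injective e ->
  oligomorphic U -> homogeneous U -> (exists r, ranks U = [set r]) ->
  is_type p ->
  exists2 f : U -> U, @embedding L U U f & forall x, typeset p (f x).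
Proof.
move=> einj olig hom [r rE] tp.
have rr (q : set U * U) : is_type q -> rank q = r.
  by move=> tq; have : ranks U (rank q) by [exists q]; rewrite rE.
have t0 x : @is_type L U (set0, x) by split; [apply: finite_set0|].
apply: (typeset_compactness e) => //; first by case: tp.
move=> n.
have sub : initial_segment e n `<=` typeset (set0, p.2).
  by move=> x _; apply: homogeneous_transitive; rewrite // !rr.
have : rank (set0, p.2) (induced (initial_segment e n)).
  split; last by exists (fun a => exist _ (sval a) (sub _ (svalP a)));
    apply: embedding_inclusion.
  exact/finite_induced/finite_initial_segment.
rewrite rr // -(rr p) // => -[_ [f fe]].
exact: embedding_induced_partial fe.
Qed.

End OneStructure.

Theorem theorem2p6 (L : language) (U : structure L)
    (Ucountable : countable [set: U])
    (Uoligomorphic : oligomorphic U)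
    (Uhomogeneous : homogeneous U)
    (one_rank : exists r : set (structure L), ranks U = [set r]) :
  indivisible U.
Proof.
move=> c; have /countable_injP[e /in2TT einj] := Ucountable.
have [[p tp cp]|stuck] := pselect (exists2 p : set U * U, is_type p &
    forall y, typeset p y -> c y = false).
  have [f fe fp] := one_rank_embedding_typeset e p einj Uoligomorphic
    Uhomogeneous one_rank tp.
  by exists f => //; exists false => _ [x _ <-]; apply: cp.
(* With no typeset entirely [false], every typeset has a point coloured [true], as the greedy
   construction requires. *)
have [p tp|f fe fc] := greedy_embedding e [set y | c y = true] einj.
  apply: contrapT => np; apply: stuck; exists p => // y py.
  by apply/negP => cy; apply: np; exists y.
by exists f => //; exists true => _ [x _ <-]; apply: fc.
Qed.
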